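(* In the setting described in the context, for every $z_i\in D$ the Shapley value of $z_i$ with respect to $v$ satisfies $$\phi_{z_i}=\frac{2\,\mathbb{1}[y_i=y^{(\mathrm{val})}]-1}{N}\sum_{\ell=0}^{N-1}\binom{N-1}{\ell}^{-1}G_{i,\ell}.$$
   Context: Training set $D=\{z_1,\dots,z_N\}$, $z_i=(x_i,y_i)$, validation point $z^{(\mathrm{val})}=(x^{(\mathrm{val})},y^{(\mathrm{val})})$, points indexed so that $d(x_1,x^{(\mathrm{val})})\le\cdots\le d(x_N,x^{(\mathrm{val})})$. For $S\subseteq D$ and $1\le j\le|S|$, $\alpha(S,j)$ is the $j$-th smallest index of a point of $S$. Integer $K\ge1$; weights $w_j\in[0,1]$; signed weights $\widetilde w_j=w_j$ if $y_j=y^{(\mathrm{val})}$, $\widetilde w_j=-w_j$ otherwise. Utility $v(S)=\mathbb{1}[\sum_{j=1}^{\min(K,|S|)}\widetilde w_{\alpha(S,j)}\ge0]$ (empty sum $=0$). Shapley value: $\phi_{z}=\frac1N\sum_{k=1}^N\binom{N-1}{k-1}^{-1}\sum_{S\subseteq D\setminus\{z\},|S|=k-1}[v(S\cup\{z\})-v(S)]$. Conditions for $S\subseteq D\setminus\{z_i\}$: $\mathrm{Cond}_{KNN}$: $|\{z_j\in S:j<i\}|\le K-1$. $\mathrm{Cond}_{0\to1}$: if $|S|\le K-1$, $\sum_{z_j\in S}\widetilde w_j\in[-\widetilde w_i,0)$; if $|S|\ge K$, $\sum_{j=1}^{K-1}\widetilde w_{\alpha(S,j)}\in[-w_i,-\widetilde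 w_{\alpha(S,K)})$. $\mathrm{Cond}_{1\to0}$: if $|S|\le K-1$, $\sum_{z_j\in S}\widetilde w_j\in[0,-\widetilde w_i)$; if $|S|\ge K$, $\sum_{j=1}^{K-1}\widetilde w_{\alpha(S,j)}\in[-\widetilde w_{\alpha(S,K)},-\widetilde w_i)$. $G_{i,\ell}$ is the number of subsets $S\subseteq D\setminus\{z_i\}$ with $|S|=\ell$ satisfying $\mathrm{Cond}_{KNN}$ and, additionally, $\mathrm{Cond}_{0\to1}$ if $y_i=y^{(\mathrm{val})}$, or $\mathrm{Cond}_{1\to0}$ if $y_i\ne y^{(\mathrm{val})}$.
   Formalization: The formal theorem additionally assumes that the weights are nonincreasing in the index (w_j ≤ w_i whenever i ≤ j, so nearer points weigh at least as much); without this the formula fails, e.g. N=3, K=2, w=(1/2,1/10,9/10), only y_1 ≠ y^(val), i=2. *)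

(* Defs.v *)
From HB Require Import structures.
From mathcomp Require Import all_boot all_order all_algebra.

Set Implicit Arguments.
Unset Strict Implicit.
Unset Printing Implicit Defensive.

Import Order.TTheory GRing.Theory Num.Theory.
Local Open Scope ring_scope.

Definition shapley (R : realFieldType) (N : nat)
    (v : {set 'I_N} -> R) (i : 'I_N) : R :=
  N%:R^-1 * \sum_(1 <= k < N.+1)
    'C(N.-1, k.-1)%:R^-1 *
      \sum_(S : {set 'I_N} | (i \notin S) && (#|S| == k.-1))
        (v (i |: S) - v S).

(* A data point is represented by its index, so the point numbered j in
   1, ..., N is the ordinal j.-1, and sets of points are sets of ordinals. *)

(* [enum S] lists S in increasing order.  The rank j starts at 1; the value is
   [None] when j exceeds #|S|, and only 1 <= j <= #|S| is used below. *)
Definition alpha (N : nat) (S : {set 'I_N}) (j : nat) : option 'I_N :=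
  onth (enum S) j.-1.

Section WeightedKNN.

Variables (R : realFieldType) (Y : eqType) (N K : nat).
Variables (y : 'I_N -> Y) (yval : Y) (w : 'I_N -> R).

Definition sweight (j : 'I_N) : R := if y j == yval then w j else - w j.

(* The signed weight of the point alpha(S, j), for 1 <= j <= #|S|. *)
Definition sweight_alpha (S : {set 'I_N}) (j : nat) : R :=
  oapp sweight 0 (alpha S j).

Definition utility (S : {set 'I_N}) : R :=
  (0 <= \sum_(1 <= j < (minn K #|S|).+1) sweight_alpha S j)%R%:R.

Definition cond_KNN (i : 'I_N) (S : {set 'I_N}) : bool :=
  (#|[set j in S | (j < i)%N]| <= K - 1)%N.

Definition cond_01 (i : 'I_N) (S : {set 'I_N}) : bool :=
  if (#|S| <= K - 1)%N then
    \sum_(j in S) sweight j \in `[- sweight i, 0[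
  else
    \sum_(1 <= j < K) sweight_alpha S j \in `[- w i, - sweight_alpha S K[.

Definition cond_10 (i : 'I_N) (S : {set 'I_N}) : bool :=
  if (#|S| <= K - 1)%N then
    \sum_(j in S) sweight j \in `[0, - sweight i[
  else
    \sum_(1 <= j < K) sweight_alpha S j
      \in `[- sweight_alpha S K, - sweight i[.

Definition G (i : 'I_N) (l : nat) : nat :=
  #|[set S : {set 'I_N} |
      [&& i \notin S, #|S| == l, cond_KNN i S
        & if y i == yval then cond_01 i S else cond_10 i S]]|.

End WeightedKNN.

(* Main.v *)
(** Listing the points in increasing order, [S] reads [A ++ B] and [i |: S]
    reads [A ++ i :: B], where [A] collects the points of [S] before [i].  If
    [A] has at least [K] points, adding [i] does not change the [K] nearest
    neighbours.  Otherwise, the neighbours taken from [i |: S] and from [S]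
    are the [K - 1] nearest points of [S], completed by [i] and by the [K]-th
    point of [S] respectively; when [#|S| < K] the latter does not exist, and
    [sweight_alpha] gives it weight [0], so that both branches of the conditions
    [0 -> 1] and [1 -> 0] read the same.  The [K]-th point of [S] lies after
    [i], so its weight is at most [w i] in absolute value: the marginal
    contribution of [i] has the sign given by its label, and is nonzero exactly
    when the total weight of the [K - 1] common neighbours lies between the
    opposites of the two signed weights. *)
Require Import Defs.
From mathcomp Require Import all_boot all_order all_algebra.

Set Implicit Arguments.
Unset Strict Implicit.
Unset Printing Implicit Defensive.

Import Order.TTheory GRing.Theory Num.Theory.
Local Open Scope ring_scope.

Lemma sum_onth_take (V : nmodType) (T : Type) (f : T -> V) (s : seq T)
    (n : nat) :
  \sum_(1 <= j < n.+1) oapp f 0 (onth s j.-1) = \sum_(j <- take n s) f j.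
Proof.
rewrite big_add1 /=; elim: s n => [|a s IHs] n.
  by rewrite big_nil big1 // => -[].
case: n => [|n]; first by rewrite big_geq // big_nil.
by rewrite big_nat_recl //= big_cons -IHs.
Qed.

Lemma takel_cat_cons (T : Type) (n : nat) (s1 s2 : seq T) (x : T) :
  (n <= size s1)%N -> take n (s1 ++ x :: s2) = take n (s1 ++ s2).
Proof. by move=> le_n; rewrite !takel_cat. Qed.

Lemma perm_take_cat_cons (T : eqType) (n : nat) (s1 s2 : seq T) (x : T) :
  (size s1 <= n)%N ->
  perm_eq (take n.+1 (s1 ++ x :: s2)) (x :: take n (s1 ++ s2)).
Proof.
move=> le_n; rewrite -cat_rcons !take_cat size_rcons ltnS ltnNge le_n /=.
by rewrite subSS cat_rcons perm_catC /= perm_cons perm_catC.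
Qed.

Lemma ge0_addr_itv (R : realDomainType) (a s t : R) : t <= s ->
  (0 <= a + s)%R%:R - (0 <= a + t)%R%:R = (a \in `[- s, - t[)%:R :> R.
Proof.
move=> le_ts; have ge0_mono : 0 <= a + t -> 0 <= a + s.
  by move/le_trans; apply; rewrite lerD2l.
rewrite in_itv /= ltNge -[- s <= a]subr_ge0 -[- t <= a]subr_ge0 !opprK.
by case: (0 <= a + t) ge0_mono => [-> //|_]; rewrite ?subrr ?subr0 ?andbT.
Qed.

Lemma shapley_signed_indicator (R : realFieldType) (N : nat)
    (v : {set 'I_N} -> R) (i : 'I_N) (c : R) (P : pred {set 'I_N}) :
  (forall S : {set 'I_N}, i \notin S -> v (i |: S) - v S = c * (P S)%:R) ->
  shapley v i =
    c / N%:R * \sum_(0 <= l < N) 'C(N.-1, l)%:R^-1 *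
      #|[set S : {set 'I_N} | [&& i \notin S, #|S| == l & P S]]|%:R.
Proof.
move=> marginal_v; rewrite /shapley big_add1 /= [c / _]mulrC -mulrA.
congr (_ * _); rewrite mulr_sumr; apply: eq_bigr => l _.
rewrite mulrCA; congr (_ * _).
under eq_bigr => S /andP[iNS _] do rewrite marginal_v //.
rewrite -mulr_sumr -natr_sum -big_mkcondr sum1_card cardsE; congr (_ * _%:R).
by apply: eq_card => S; rewrite unfold_in /= -andbA.
Qed.

Lemma lt_sorted_enum_ord (N : nat) (A : {pred 'I_N}) : sorted <%O (enum A).
Proof.
rewrite [enum A]/enum_mem -enumT lt_sorted_filter //.
by have := iota_ltn_sorted 0 N; rewrite -val_enum_ord sorted_map.
Qed.

Lemma eq_enum_ord (N : nat) (A : {pred 'I_N}) (s : seq 'I_N) :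
  sorted <%O s -> s =i A -> enum A = s.
Proof.
move=> s_sorted sA; apply: lt_sorted_eq s_sorted _ => [|j].
  exact: lt_sorted_enum_ord.
by rewrite mem_enum sA.
Qed.

Section OrdinalCut.

Variables (N : nat) (i : 'I_N) (S : {set 'I_N}).

Definition below : {set 'I_N} := [set j in S | (j < i)%N].
Definition above : {set 'I_N} := [set j in S | (i < j)%N].

Let sorted_below_above : sorted <%O (enum below ++ i :: enum above).
Proof.
have below_lt j : j \in enum below -> (j < i)%O.
  by rewrite mem_enum inE => /andP[].
have above_gt j : j \in enum above -> (i < j)%O.
  by rewrite mem_enum inE => /andP[].
rewrite lt_sorted_pairwise pairwise_cat /= -!lt_sorted_pairwise.
rewrite !lt_sorted_enum_ord !andbT; apply/andP; split; last exact/allP.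
apply/allrelP => j k /below_lt lt_ji; rewrite inE => /predU1P[-> //|/above_gt].
exact: lt_trans.
Qed.

Lemma enum_setU1_cut : enum (i |: S) = enum below ++ i :: enum above.
Proof.
apply: eq_enum_ord => // j; rewrite mem_cat inE !mem_enum !inE -val_eqE /=.
by case: ltngtP; rewrite /= ?andbT ?andbF ?orbF.
Qed.

Hypothesis iNS : i \notin S.

Lemma enum_set_cut : enum S = enum below ++ enum above.
Proof.
apply: eq_enum_ord => [|j].
  apply: subseq_lt_sorted sorted_below_above.
  by rewrite cat_subseq ?subseq_cons.
rewrite mem_cat !mem_enum !inE; case: ltngtP => [||/val_inj ->];
  by rewrite ?andbT ?andbF ?orbF // (negPf iNS).
Qed.

Lemma alpha_gt (j : nat) (k : 'I_N) :
  (#|below| < j)%N -> alpha S j = Some k -> (i < k)%N.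
Proof.
case: j => // j; rewrite /alpha enum_set_cut onth_cat -cardE ltnS ltnNge => ->.
move=> /= alpha_k; have : k \in enum above.
  by apply/onthP; exists (j - #|below|)%N.
by rewrite mem_enum inE => /andP[].
Qed.

End OrdinalCut.

Definition nearest (N n : nat) (S : {set 'I_N}) : seq 'I_N := take n (enum S).

Lemma nearest_oversize (N n : nat) (S : {set 'I_N}) :
  (#|S| <= n)%N -> nearest n S = enum S.
Proof. by move=> le_Sn; rewrite /nearest take_oversize // -cardE. Qed.

Lemma nearest_setU1_far (N n : nat) (i : 'I_N) (S : {set 'I_N}) :
  i \notin S -> (n <= #|below i S|)%N -> nearest n (i |: S) = nearest n S.
Proof.
move=> iNS le_n; rewrite /nearest enum_setU1_cut (enum_set_cut iNS).
by rewrite takel_cat_cons // -cardE.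
Qed.

Lemma perm_nearest_setU1 (N n : nat) (i : 'I_N) (S : {set 'I_N}) :
  i \notin S -> (#|below i S| <= n)%N ->
  perm_eq (nearest n.+1 (i |: S)) (i :: nearest n S).
Proof.
move=> iNS le_n; rewrite /nearest enum_setU1_cut (enum_set_cut iNS).
by rewrite perm_take_cat_cons // -cardE.
Qed.

Section WeightedKNN.

Variables (R : realFieldType) (Y : eqType) (N : nat).
Variables (y : 'I_N -> Y) (yval : Y) (w : 'I_N -> R).

Local Notation sw := (sweight y yval w).
Local Notation sw_alpha := (sweight_alpha y yval w).

Lemma sweight_same (j : 'I_N) : y j == yval -> sw j = w j.
Proof. by rewrite /sweight => ->. Qed.

Lemma sweight_diff (j : 'I_N) : y j != yval -> sw j = - w j.
Proof. by rewrite /sweight => /negPf->. Qed.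

Lemma normr_sweight (j : 'I_N) : 0 <= w j -> `|sw j| = w j.
Proof.
by move=> wj_ge0; rewrite /sweight; case: ifP; rewrite ?normrN ger0_norm.
Qed.

Definition nearest_weight (n : nat) (S : {set 'I_N}) : R :=
  \sum_(1 <= j < n.+1) sw_alpha S j.

Lemma nearest_weightE (n : nat) (S : {set 'I_N}) :
  nearest_weight n S = \sum_(j <- nearest n S) sw j.
Proof. exact: sum_onth_take. Qed.

Lemma nearest_weightS (n : nat) (S : {set 'I_N}) :
  nearest_weight n.+1 S = nearest_weight n S + sw_alpha S n.+1.
Proof. by rewrite /nearest_weight big_nat_recr. Qed.

Lemma nearest_weight_oversize (n : nat) (S : {set 'I_N}) :
  (#|S| <= n)%N -> nearest_weight n S = \sum_(j in S) sw j.
Proof.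
by move=> le_Sn; rewrite nearest_weightE nearest_oversize // big_enum.
Qed.

Lemma nearest_weight_setU1 (n : nat) (i : 'I_N) (S : {set 'I_N}) :
  i \notin S -> (#|below i S| <= n)%N ->
  nearest_weight n.+1 (i |: S) = nearest_weight n S + sw i.
Proof.
move=> iNS le_n; rewrite !nearest_weightE.
by rewrite (perm_big _ (perm_nearest_setU1 iNS le_n)) big_cons addrC.
Qed.

Lemma sweight_alpha_default (S : {set 'I_N}) (j : nat) :
  (#|S| < j)%N -> sw_alpha S j = 0.
Proof.
by case: j => // j lt_Sj; rewrite /sweight_alpha /alpha onth_default // -cardE.
Qed.

Lemma utilityE (K : nat) (S : {set 'I_N}) :
  utility K y yval w S = (0 <= nearest_weight K S)%R%:R.
Proof.
rewrite /utility -/(nearest_weight _ _).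
case: (leqP K #|S|) => // /ltnW le_SK.
by rewrite !nearest_weight_oversize.
Qed.

Lemma cond_01E (K : nat) (i : 'I_N) (S : {set 'I_N}) : y i == yval ->
  cond_01 K.+1 y yval w i S =
  (nearest_weight K S \in `[- sw i, - sw_alpha S K.+1[).
Proof.
move=> same_label.
rewrite /cond_01 subn1 /= sweight_same //; case: leqP => // le_SK.
by rewrite nearest_weight_oversize // sweight_alpha_default // oppr0.
Qed.

Lemma cond_10E (K : nat) (i : 'I_N) (S : {set 'I_N}) :
  cond_10 K.+1 y yval w i S =
  (nearest_weight K S \in `[- sw_alpha S K.+1, - sw i[).
Proof.
rewrite /cond_10 subn1 /=; case: leqP => // le_SK.
by rewrite nearest_weight_oversize // sweight_alpha_default // oppr0.
Qed.

Definition pivotal (K : nat) (i : 'I_N) (S : {set 'I_N}) : bool :=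
  cond_KNN K i S &&
  (if y i == yval then cond_01 K y yval w i S else cond_10 K y yval w i S).

Hypothesis w_ge0 : forall j, 0 <= w j.
Hypothesis w_nonincreasing : forall i j : 'I_N, (i <= j)%N -> w j <= w i.

Lemma normr_sweight_alpha_le (i : 'I_N) (S : {set 'I_N}) (j : nat) :
  i \notin S -> (#|below i S| < j)%N -> `|sw_alpha S j| <= w i.
Proof.
move=> iNS lt_j; rewrite /sweight_alpha.
case alpha_j: (alpha S j) => [k|] /=; last by rewrite normr0.
by rewrite normr_sweight // w_nonincreasing // ltnW // (alpha_gt iNS lt_j).
Qed.

Lemma marginal_utility (K : nat) (i : 'I_N) (S : {set 'I_N}) : i \notin S ->
  utility K.+1 y yval w (i |: S) - utility K.+1 y yval w S =
  (2 * (y i == yval)%:R - 1) * (pivotal K.+1 i S)%:R.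
Proof.
move=> iNS; rewrite !utilityE /pivotal /cond_KNN subn1 -/(below i S) /=.
have [near | far] := leqP #|below i S| K; last first.
  by rewrite !nearest_weightE nearest_setU1_far // subrr mulr0.
rewrite nearest_weight_setU1 // nearest_weightS /=.
have /ler_normlP[] := normr_sweight_alpha_le iNS (near : (_ < K.+1)%N).
have [same_label | diff_label] := boolP (y i == yval).
  move=> _ le_alpha; rewrite cond_01E // ge0_addr_itv.
    by rewrite mulr1 addrK mul1r.
  by rewrite sweight_same.
rewrite lerNl => ge_alpha _; rewrite cond_10E mulr0 sub0r mulN1r -opprB.
by rewrite ge0_addr_itv // sweight_diff.
Qed.

End WeightedKNN.

Theorem theorem2 (R : realFieldType) (X : Type) (Y : eqType) (N K : nat)
    (d : X -> X -> R) (x : 'I_N -> X) (y : 'I_N -> Y) (xval : X) (yval : Y)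
    (w : 'I_N -> R)
    (K_ge1 : (1 <= K)%N)
    (sorted_dist : forall i j : 'I_N, (i <= j)%N ->
       d (x i) xval <= d (x j) xval)
    (w_bound : forall j : 'I_N, 0 <= w j <= 1)
    (w_nonincreasing : forall i j : 'I_N, (i <= j)%N -> w j <= w i)
    (i : 'I_N) :
  shapley (utility K y yval w) i =
    (2 * (y i == yval)%:R - 1) / N%:R *
      \sum_(0 <= l < N) 'C(N.-1, l)%:R^-1 * (G K y yval w i l)%:R.
Proof.
have w_ge0 j : 0 <= w j by case/andP: (w_bound j).
case: K K_ge1 => // K _; apply: shapley_signed_indicator => S.
exact: marginal_utility.
Qed.
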